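(* A topological space $X$ is Choquet complete (i.e. player $\alpha$ has a winning strategy in the strong Choquet game on $X$) if and only if $X$ is F-Y countably domain representable.
   Context: No separation axioms are assumed. For a topological space $X$, $\tau(X)$ denotes its topology and $\tau^*(X)$ the family of nonempty open sets. Strong Choquet game $Ch(X)$: players $\beta$ and $\alpha$ alternate. In round $0$, $\beta$ chooses a point $x_0$ and an open set $U_0\ni x_0$, and $\alpha$ responds with an open set $V_0$ with $x_0\in V_0\subseteq U_0$. In round $n\geq 1$, $\beta$ chooses a point $x_n$ and an open set $U_n$ with $x_n\in U_n\subseteq V_{n-1}$, and $\alpha$ responds with an open set $V_n$ with $x_n\in V_n\subseteq U_n$. Player $\alpha$ wins if $\bigcap\{V_n:n\in\omega\}\neq\emptyset$; otherwise $\beta$ wins. A strategy for $\alpha$ is a map $s$ assigning to each finite legal sequence of moves of $\beta$, $(U_0,x_0,\ldots,U_n,x_n)$ (in which $\alpha$'s earlier responses are $V_k=s(U_0,x_0,\ldots,U_k,x_k)$), a legal response $V_n=s(U_0,x_0,\ldots,U_n,x_n)$ of $\alpha$; it is winning if $\alpha$ wins every infinite play in which $\alpha$ follows $s$. $X$ is Choquet complete if $\alpha$ has a winning strategy in $Ch(X)$. A set $D$ with a relation $\ll$ is upward directed if it is nonempty and for all $p,q\in D$ (not necessarily distinct) there is $r\in D$ with $p\ll r$ and $q\ll r$. $X$ is F-Y (Fleissner--Yengulalp) countably domain representable if there is a triple $(Q,\ll,B)$ such that: (D1) $B:Q\to\tau^*(X)$ and $\{B(q):q\in Q\}$ is a base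 for $\tau(X)$; (D2) $\ll$ is a transitive relation on $Q$ (antisymmetry is not assumed); (D3) for all $p,q\in Q$, $p\ll q$ implies $B(p)\supseteq B(q)$; (D4) for all $x\in X$, the set $\{q\in Q:x\in B(q)\}$ is upward directed by $\ll$; (D5$_{\omega_1}$) if $D\subseteq Q$ and $(D,\ll)$ is countable and upward directed, then $\bigcap\{B(q):q\in D\}\neq\emptyset$. *)

(* Defs.v *)
From HB Require Import structures.
From mathcomp Require Import all_boot all_order.
From mathcomp Require Import boolp classical_sets functions cardinality filter.
From mathcomp Require Import topology.

Set Implicit Arguments.
Unset Strict Implicit.
Unset Printing Implicit Defensive.

Local Open Scope classical_set_scope.

Section StrongChoquetGame.
Variable X : topologicalType.

(* A history [:: (U_0, x_0); ...; (U_n, x_n)] lists the moves of beta in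
   chronological order; [s h] is alpha's answer to the last move of [h].  The
   values of [s] on the empty list and on illegal histories are irrelevant. *)
Implicit Types (s : seq (set X * X) -> set X) (h : seq (set X * X)).

(* The moves of beta in [h] are legal when alpha's answers are given by [s]. *)
Inductive legal_history s : seq (set X * X) -> Prop :=
| legal_first U x : open U -> U x -> legal_history s [:: (U, x)]
| legal_next h U x : legal_history s h ->
    open U -> U x -> U `<=` s h -> legal_history s (rcons h (U, x)).

Definition alpha_strategy s : Prop :=
  forall h U x, legal_history s (rcons h (U, x)) ->
    let V := s (rcons h (U, x)) in [/\ open V, V x & V `<=` U].

(* [mkseq p n.+1] is the history [:: p 0; ...; p n]. *)
Definition alpha_winning s : Prop :=
  forall p : nat -> set X * X,
    (forall n, legal_history s (mkseq p n.+1)) ->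
    \bigcap_(n in [set: nat]) s (mkseq p n.+1) !=set0.

Definition choquet_complete : Prop :=
  exists2 s, alpha_strategy s & alpha_winning s.

End StrongChoquetGame.

Definition upward_directed (Q : Type) (ll : Q -> Q -> Prop) (D : set Q) : Prop :=
  D !=set0 /\
  forall p q, D p -> D q -> exists r, [/\ D r, ll p r & ll q r].

Record FY_countable_domain (X : topologicalType) (Q : Type)
    (ll : Q -> Q -> Prop) (B : Q -> set X) : Prop := {
  FY_nonempty : forall q, B q !=set0;
  (* [basis] includes the openness of every [B q] *)
  FY_basis : basis (range B);
  FY_trans : forall p q r, ll p q -> ll q r -> ll p r;
  FY_anti : forall p q, ll p q -> B q `<=` B p;
  FY_directed : forall x : X, upward_directed ll [set q | B q x];
  FY_complete : forall D : set Q, countable D -> upward_directed ll D ->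
    \bigcap_(q in D) B q !=set0
}.

Definition FY_countably_domain_representable (X : topologicalType) : Prop :=
  exists (Q : Type) (ll : Q -> Q -> Prop) (B : Q -> set X),
    FY_countable_domain ll B.

(* Main.v *)
(* If a countable F-Y domain is given, alpha answers with B (q_n) where q_0 << q_1 << ...;
   the set of all q_n is countable and upward directed.  Conversely, given a winning
   strategy s, let Q consist of the finite nonempty sets F of legal histories whose
   answers s h (h in F) have a common point, with B F the intersection of these answers,
   and let F << G when every h in F has a proper extension h' in G with s h' included in
   B F.  Given a point x of B F and of B G, extending every history of F and G by the move
   (B F `&` B G, x) yields a common upper bound.  A countable upward directed set has a
   cofinal <<-increasing sequence F_0 << F_1 << ...; choosing successive extensions
   h_n in F_n gives a play, and a point won by alpha lies in s h_{n+1}, hence in B F_n. *)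
Require Import Defs.
From mathcomp Require Import all_boot all_order.
From mathcomp Require Import boolp classical_sets cardinality.
From mathcomp Require Import topology.

Set Implicit Arguments.
Unset Strict Implicit.
Unset Printing Implicit Defensive.

Local Open Scope classical_set_scope.

Section UpwardDirected.
Variables (Q : Type) (ll : Q -> Q -> Prop).
Hypothesis ll_trans : forall p q r, ll p q -> ll q r -> ll p r.

Lemma increasing_upward_directed (q : nat -> Q) :
  (forall n, ll (q n) (q n.+1)) -> upward_directed ll (range q).
Proof.
move=> qS; split; first by exists (q 0%N), 0%N.
have ll_mono : {homo q : i j / (i < j)%N >-> ll i j}.
  by apply: homo_ltn qS => y x z; apply: ll_trans.
move=> _ _ [i _ <-] [j _ <-]; exists (q (maxn i j).+1).
by split; [exists (maxn i j).+1 | apply/ll_mono; rewrite ltnS leq_maxl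
  | apply/ll_mono; rewrite ltnS leq_maxr].
Qed.

(** Enumerate [D] as [e 0, e 1, ...] and choose [q n.+1] in [D] above both [q n] and [e n]. *)
Lemma countable_directed_cofinal (D : set Q) :
  countable D -> upward_directed ll D ->
  exists q : nat -> Q, [/\ forall n, D (q n), forall n, ll (q n) (q n.+1)
    & forall d, D d -> exists n, ll d (q n)].
Proof.
move=> /countable_injP[f f_inj] [[d0 Dd0] dirD].
(* [e] inverts the injection [f] on the image of [D] and takes the default [d0] elsewhere, so a
   finite [D] is covered too. *)
have /choice[e eP] : forall n, exists d', D d' /\ forall d, D d -> f d = n -> d' = d.
  move=> n; have [[d [Dd fd]]|no_d] := pselect (exists d, D d /\ f d = n).
    exists d; split=> // d' Dd' fd'; apply: f_inj; rewrite ?inE //.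
    by rewrite fd fd'.
  by exists d0; split=> // d Dd fd; case: no_d; exists d.
have /choice[g gP] : forall pq : Q * Q, exists r, D pq.1 -> D pq.2 ->
    [/\ D r, ll pq.1 r & ll pq.2 r].
  move=> [p q] /=.
  have [[Dp Dq]|nDpq] := pselect (D p /\ D q); last first.
    by exists p => Dp Dq; case: nDpq.
  by have [r rP] := dirD p q Dp Dq; exists r.
pose q := fix q n := if n is m.+1 then g (q m, e m) else d0.
have Dq n : D (q n).
  by elim: n => //= n Dqn; case: (gP (q n, e n) Dqn (eP n).1).
exists q; split=> // [n|d Dd].
  by case: (gP (q n, e n) (Dq n) (eP n).1).
(* [d] is [e (f d)], which is dominated one step later. *)
exists (f d).+1; case: (gP (q (f d), e (f d)) (Dq _) (eP _).1) => _ _ /=.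
by rewrite {1}((eP (f d)).2 d).
Qed.

End UpwardDirected.

Section Game.
Variable X : topologicalType.
Implicit Types (s : seq (set X * X) -> set X) (h t : seq (set X * X)).

Lemma legal_rcons s h U x : legal_history s (rcons h (U, x)) ->
  [/\ open U, U x & h = [::] \/ legal_history s h /\ U `<=` s h].
Proof.
move E : (rcons h (U, x)) => h' h'_legal.
case: h'_legal E => [V y oV Vy|k V y k_legal oV Vy Vsk] E.
  by have [-> -> ->] := @rcons_inj _ h [::] _ _ E; split=> //; left.
by have [-> -> ->] := rcons_inj E; split=> //; right.
Qed.

Lemma legal_history_neq0 s h : legal_history s h -> h != [::].
Proof. by case=> // k U x *; rewrite -size_eq0 size_rcons. Qed.

Lemma legal_prefix s h t :
  h != [::] -> legal_history s (h ++ t) -> legal_history s h.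
Proof.
move=> h0; elim/last_ind: t => [|t [U x] IH]; first by rewrite cats0.
rewrite -rcons_cat => /legal_rcons[_ _ [/nilP|[/IH//]]].
by rewrite /nilp size_cat addn_eq0 size_eq0 (negPf h0).
Qed.

Lemma strategy_open s h : alpha_strategy s -> legal_history s h -> open (s h).
Proof.
move=> sP; elim/last_ind: h => [/legal_history_neq0//|h [U x] _ h_legal].
by have [] := sP _ _ _ h_legal.
Qed.

Lemma strategy_cat_sub s h t : alpha_strategy s -> h != [::] ->
  legal_history s (h ++ t) -> s (h ++ t) `<=` s h.
Proof.
move=> sP h0; elim/last_ind: t => [|t [U x] IH]; first by rewrite cats0 => _ y.
rewrite -rcons_cat => ht_legal; have [_ _ sU] := sP _ _ _ ht_legal.
have [_ _ [/nilP|[/IH sht Us]]] := legal_rcons ht_legal.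
  by rewrite /nilp size_cat addn_eq0 size_eq0 (negPf h0).
exact: subset_trans sU (subset_trans Us sht).
Qed.

(** The [k n] are initial segments of one infinite play, so the sets [s (k n)] are among alpha's
    answers in that play. *)
Lemma winning_increasing s (k : nat -> seq (set X * X)) : alpha_winning s ->
  (forall n, legal_history s (k n)) ->
  (forall n, exists2 t, t != [::] & k n.+1 = k n ++ t) ->
  \bigcap_n s (k n) !=set0.
Proof.
move=> s_win k_legal kS.
have k_size n : (n < size (k n))%N.
  elim: n => [|n IH]; first by rewrite lt0n size_eq0 (legal_history_neq0 (k_legal _)).
  have [t t0 ->] := kS n; rewrite size_cat (leq_trans _ (leq_add IH (leqnn _))) //.
  by rewrite -[n.+2]addn1 leq_add2l lt0n size_eq0.
have k_prefix m n : (m <= n)%N -> exists t, k n = k m ++ t.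
  elim: n => [|n IH]; first by rewrite leqn0 => /eqP->; exists [::]; rewrite cats0.
  rewrite leq_eqVlt => /orP[/eqP->|/IH[t kn]]; first by exists [::]; rewrite cats0.
  by have [t' _ ->] := kS n; exists (t ++ t'); rewrite kn catA.
have [a _] : exists a : set X * X, True by case: (k 0%N) (k_size 0%N) => // a; exists a.
(* Move [i] is read off [k i], which is already longer than [i]; by [k_prefix], every [k n] longer
   than [i] has the same move there. *)
pose p i := nth a (k i) i.
have p_nth n i : (i < size (k n))%N -> p i = nth a (k n) i.
  move=> i_lt; rewrite /p; case: (leqP i n) => [/k_prefix[t ->]|/ltnW/k_prefix[t ->]].
    by rewrite nth_cat k_size.
  by rewrite nth_cat i_lt.
have mkseq_k n : mkseq p (size (k n)) = k n.
  apply: (@eq_from_nth _ a) => [|i]; rewrite size_mkseq // => i_lt.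
  by rewrite nth_mkseq // (p_nth n).
have p_legal n : legal_history s (mkseq p n.+1).
  apply: (@legal_prefix _ _ (drop n.+1 (k n))); first by rewrite -size_eq0 size_mkseq.
  suff -> : mkseq p n.+1 = take n.+1 (k n) by rewrite cat_take_drop.
  by rewrite -[in RHS]mkseq_k /mkseq -map_take take_iota (minn_idPl (k_size n)).
have [y yP] := s_win p p_legal; exists y => n _.
(* The answer to a history of [m] moves has index [m.-1] in the play. *)
have := yP (size (k n)).-1 I.
by rewrite prednK ?mkseq_k // (leq_ltn_trans _ (k_size n)).
Qed.

Lemma FY_choquet_complete :
  FY_countably_domain_representable X -> choquet_complete X.
Proof.
move=> [Q [ll [B [_ [B_open B_basis] ll_trans ll_sub B_dir B_complete]]]].
(* Alpha remembers only the last element chosen; [None] is the state before the first round and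
   imposes no constraint. *)
pose Bo (o : option Q) := if o is Some q then B q else setT.
pose llo (o : option Q) r := if o is Some q then ll q r else True.
have /choice[step stepP] : forall om : option Q * (set X * X), exists o' : option Q,
    open om.2.1 -> om.2.1 om.2.2 -> Bo om.1 om.2.2 ->
    exists r, [/\ o' = Some r, B r om.2.2, B r `<=` om.2.1 & llo om.1 r].
  move=> [o [U x]] /=.
  have [[oU Ux Box]|nP] := pselect [/\ open U, U x & Bo o x]; last first.
    by exists None => oU Ux Box; case: nP.
  have [_ [[q _ <-] /= Bqx] BqU] := B_basis x U (open_nbhs_nbhs (conj oU Ux)).
  (* Directedness at [x] gives [r] above [q], which keeps [B r] inside [U], and above the previous
     choice; in the first round [q] is paired with itself. *)
  have [r [Brx qr or]] : exists r, [/\ B r x, ll q r & llo o r].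
    case: o Box => [p|] Box; have [_ dirx] := B_dir x.
      by have [r [? ? ?]] := dirx q p Bqx Box; exists r.
    by have [r [? ? ?]] := dirx q q Bqx Bqx; exists r.
  exists (Some r) => _ _ _; exists r; split=> //.
  exact: subset_trans (ll_sub _ _ qr) BqU.
pose st h := foldl (fun o m => step (o, m)) None h.
pose s h := Bo (st h).
have s_step h U x : legal_history s (rcons h (U, x)) ->
    exists r, [/\ st (rcons h (U, x)) = Some r, B r x, B r `<=` U & llo (st h) r].
  move=> /legal_rcons[oU Ux h_legal]; rewrite /st foldl_rcons -/(st h).
  apply: (stepP (st h, (U, x))) => //=.
  by case: h_legal => [->//|[_ Us]]; apply: Us.
exists s => [h U x /s_step[r [sr Brx BrU _]]|p p_legal].
  by rewrite /= /s sr /=; split=> //; apply: B_open; exists r.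
have /choice[q qP] : forall n, exists r, st (mkseq p n.+1) = Some r.
  move=> n; have := p_legal n; rewrite mkseqS; case: (p n) => U x.
  by move=> /s_step[r [? _ _ _]]; exists r.
have qS n : ll (q n) (q n.+1).
  have := p_legal n.+1; have := qP n.+1; rewrite (mkseqS p n.+1); case: (p n.+1) => U x.
  move=> qn /s_step[r []]; rewrite qn => -[<-] _ _.
  by rewrite qP.
have [y yP] := B_complete (range q) (card_image_le _ _)
  (increasing_upward_directed ll_trans qS).
by exists y => n _; rewrite /s qP /=; apply: yP; exists n.
Qed.

Lemma choquet_complete_FY :
  choquet_complete X -> FY_countably_domain_representable X.
Proof.
move=> [s sP s_win].
pose BF (F : set (seq (set X * X))) := \bigcap_(h in F) s h.
(* Finiteness makes [BF F] open; [F !=set0] supplies the history from which [ll] yields an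
   inclusion. *)
pose Qprop F := [/\ F !=set0, finite_set F, F `<=` legal_history s & BF F !=set0].
pose Q := {F | Qprop F}.
pose B (q : Q) := BF (sval q).
pose ll (p q : Q) := forall h, sval p h ->
  exists t, [/\ t != [::], sval q (h ++ t) & s (h ++ t) `<=` B p].
have ll_trans p q r : ll p q -> ll q r -> ll p r.
  move=> pq qr h /pq[t [t0 qht st]]; have [t' [t'0 rhtt' _]] := qr _ qht.
  exists (t ++ t'); rewrite catA; split=> //.
    by rewrite -size_eq0 size_cat addn_eq0 size_eq0 (negPf t0).
  have [_ _ q_legal _] := svalP q; have [_ _ r_legal _] := svalP r.
  (* Alpha's answers shrink along a play, so the answer to the longer history stays inside [B p]. *)
  apply: subset_trans st; apply: strategy_cat_sub => //.
    exact: legal_history_neq0 (q_legal _ qht).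
  exact: r_legal.
have ll_sub p q : ll p q -> B q `<=` B p.
  move=> pq; have [[h ph] _ _ _] := svalP p.
  by have [t [_ qht st]] := pq h ph => x Bqx; apply/st/Bqx.
have B_open q : open (B q).
  have [_ F_fin F_legal _] := svalP q.
  rewrite /B /BF -bigsetI_fset_set // big_seq.
  apply: big_ind => [|U V|h]; [exact: openT|exact: openI|].
  by rewrite in_fset_set // inE => /F_legal; apply: strategy_open.
(* Singletons of one-move histories already yield a base and, with [U] the whole space, an element
   of [Q] around each point. *)
have Q_first U x : open U -> U x -> exists2 q, B q x & B q `<=` U.
  move=> oU Ux; have h_legal := legal_first s oU Ux.
  have [_ sx sU] := sP [::] U x h_legal.
  have Fprop : Qprop [set [:: (U, x)]].
    split; [by exists [:: (U, x)] | exact: finite_set1 | by move=> _ -> |].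
    by exists x => _ ->.
  exists (exist _ _ Fprop); first by move=> _ ->.
  by move=> y By; apply/sU/By.
exists Q, ll, B; split=> //.
- by move=> q; have [] := svalP q.
- split=> [_ [q _ <-]//|x U /=].
  rewrite nbhsE /= => -[V [oV Vx] VU].
  have [q Bqx BqV] := Q_first V x oV Vx.
  by exists (B q); [split=> //; exists q | exact: subset_trans VU].
- move=> x; split; first by have [q] := Q_first setT x openT I; exists q.
  move=> p q /= Bpx Bqx; pose U := B p `&` B q.
  have oU : open U by apply: openI.
  pose F := sval p `|` sval q; pose G := [set rcons h (U, x) | h in F].
  have [[h0 ph0] p_fin p_legal _] := svalP p; have [_ q_fin q_legal _] := svalP q.
  (* The move is legal after each [h] in [F] because [s h] is one of the sets intersected in [B p]
     or [B q], so it contains [U]. *)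
  have FU h : F h -> legal_history s (rcons h (U, x)).
    move=> Fh; apply: legal_next => //; first by case: Fh => [/p_legal|/q_legal].
    by case: Fh => ? y [Bpy Bqy]; [exact: Bpy|exact: Bqy].
  have BGx : BF G x by move=> _ [h Fh <-]; have [] := sP _ _ _ (FU h Fh).
  have Gprop : Qprop G.
    split; last by exists x.
    - by exists (rcons h0 (U, x)), h0 => //; left.
    - by apply: finite_image; rewrite finite_setU.
    - by move=> _ [h Fh <-]; apply: FU.
  exists (exist _ G Gprop); split=> // h Fh; exists [:: (U, x)]; rewrite cats1; split=> //.
  + by exists h => //; left.
  + have [_ _ sU] := sP _ _ _ (FU h (or_introl Fh)).
    by move=> y /sU[].
  + by exists h => //; right.
  + have [_ _ sU] := sP _ _ _ (FU h (or_intror Fh)).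
    by move=> y /sU[].
- move=> D D_count D_dir.
  have [q [Dq qS q_cof]] := countable_directed_cofinal D_count D_dir.
  have /choice[nx nxP] : forall nh : nat * seq (set X * X), exists h',
      sval (q nh.1) nh.2 -> [/\ exists2 t, t != [::] & h' = nh.2 ++ t,
        sval (q nh.1.+1) h' & s h' `<=` B (q nh.1)].
    move=> [n h] /=; have [qh|nqh] := pselect (sval (q n) h); last first.
      by exists h => qh; case: nqh.
    by have [t [t0 qht st]] := qS n h qh; exists (h ++ t) => _; split=> //; exists t.
  have [[h0 qh0] _ _ _] := svalP (q 0%N).
  pose k := fix k n := if n is m.+1 then nx (m, k m) else h0.
  have qk n : sval (q n) (k n) by elim: n => // n /(nxP (n, _))[].
  have [y yP] : \bigcap_n s (k n) !=set0.
    apply: winning_increasing => // n; first by have [_ _ + _] := svalP (q n); apply.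
    by have [] := nxP (n, k n) (qk n).
  (* For some [n], [d] is below [q n], and [y] lies in [s (k n.+1)], hence in [B (q n)] and in
     [B d]. *)
  exists y => d /q_cof[n /ll_sub]; apply.
  by have [_ _] := nxP (n, k n) (qk n); apply; apply: (yP n.+1).
Qed.

End Game.

Theorem theorem3 (X : topologicalType) :
  choquet_complete X <-> FY_countably_domain_representable X.
Proof. by split; [exact: choquet_complete_FY | exact: FY_choquet_complete]. Qed.
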